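(* Let $i\in\{1,2\}$ and let $(\Sigma_Y^\eta)$ and $(\widetilde\Sigma_Y^\eta)$ be two sequences of obstacles with $\widetilde\Sigma_Y^\eta\subset\Sigma_Y^\eta$ for every $\eta$. Then: (i) If $\widetilde\Sigma_Y^\eta$ is asymptotically connecting in the direction $e_i$, then $\Sigma_Y^\eta$ is asymptotically connecting in the direction $e_i$. (ii) If $\Sigma_Y^\eta$ is asymptotically disconnected in the direction $e_i$, then $\widetilde\Sigma_Y^\eta$ is asymptotically disconnected in the direction $e_i$.
   Context: A sequence of obstacles is a family of compact sets $\Sigma_Y^\eta\subset[0,1]^2\times(0,1)$, indexed by a sequence $\eta\to0$ of positive numbers, such that the periodic extension $\bigcup_{k\in\mathbb{Z}^2}\big((k_1,k_2,0)+\Sigma_Y^\eta\big)\subset\mathbb{R}^3$ has Lipschitz boundary. Let $Z=(0,1)^2\times\mathbb{R}$. $H_{\mathrm{loc}}(\operatorname{curl},\mathbb{R}^3)$ is the set of $u\in L^2_{\mathrm{loc}}(\mathbb{R}^3,\mathbb{C}^3)$ with distributional curl in $L^2_{\mathrm{loc}}(\mathbb{R}^3,\mathbb{C}^3)$, and $\dot H_\#(\operatorname{curl},Z)$ is the set of restrictions $u|_Z$ of functions $u\in H_{\mathrm{loc}}(\operatorname{curl},\mathbb{R}^3)$ that are $1$-periodic in the directions $e_1$ and $e_2$. Limits are along the sequence $\eta\to0$. For a sequence of obstacles $S^\eta$: - For $j\in\{1,2\}$, $S^\eta$ is asymptotically disconnected in the direction $e_j$ if there are $\Phi_\eta\in\dot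 H_\#(\operatorname{curl},Z)$ with $\eta^{1/2}\|\Phi_\eta-e_j\|_{L^2(Z)}\to0$, $\Phi_\eta=0$ (a.e.) on $S^\eta$, and $\eta^{-1/2}\|\operatorname{curl}\Phi_\eta\|_{L^2(Z)}\to0$. - For $i\in\{1,2\}$ and $j=3-i$, $S^\eta$ is asymptotically connecting in the direction $e_i$ if there are $\Psi_\eta\in\dot H_\#(\operatorname{curl},Z)$ with $\eta^{1/2}\|\Psi_\eta-e_j\mathbf{1}_{\{x_3>0\}}\|_{L^2(Z\setminus S^\eta)}\to0$ and $\eta^{-1/2}\|\operatorname{curl}\Psi_\eta\|_{L^2(Z\setminus S^\eta)}\to0$. *)

(* Defs.v *)
From HB Require Import structures.
From mathcomp Require Import all_boot all_order all_algebra.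
From mathcomp Require Import all_classical all_reals all_analysis.
From mathcomp.real_closed Require Import complex.

Set Implicit Arguments.
Unset Strict Implicit.
Unset Printing Implicit Defensive.

Import Order.TTheory GRing.Theory Num.Theory.
Import numFieldNormedType.Exports.

Local Open Scope classical_set_scope.
Local Open Scope ring_scope.

(* [R3] and [mR3] are convertible: the former carries the normed module
   structure of R^3, the latter its Borel sigma-algebra. *)
Definition R3 (R : realType) := (R * R * R)%type.

Definition mR3 (R : realType) :=
  (measurableTypeR R * measurableTypeR R * measurableTypeR R)%type.

Definition mu3 (R : realType) : {measure set (mR3 R) -> \bar R} :=
  (@lebesgue_measure R \x @lebesgue_measure R \x @lebesgue_measure R)%E.

Definition C3 (R : realType) := 'rV[R[i]]_3.

(* One-based, as in e_1, e_2, e_3. *)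
Definition e {R : realType} (j : nat) : C3 R := \row_(k < 3) (k.+1 == j)%:R.

Definition C3norm (R : realType) (z : C3 R) : R :=
  Num.sqrt (\sum_(k < 3) Normc.normc (z 0 k) ^+ 2).

Definition L2norm (R : realType) (D : set (R3 R)) (u : R3 R -> C3 R) : \bar R :=
  ('N[mu3 R]_2%:E[(fun x : R3 R => (\1_D x * C3norm (u x))%:E)])%E.

Definition L2loc (R : realType) (U : set (R3 R)) (u : R3 R -> C3 R) : Prop :=
  (forall k : 'I_3,
     measurable_fun (T := mR3 R) U (fun x => complex.Re (u x 0 k)) /\
     measurable_fun (T := mR3 R) U (fun x => complex.Im (u x 0 k))) /\
  (forall K : set (R3 R), compact K -> K `<=` U -> (L2norm K u < +oo)%E).

Definition axis (R : realType) (k : 'I_3) : R3 R :=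
  ((k == 0)%:R, (k == 1)%:R, (k == 2)%:R).

Fixpoint Ck (R : realType) (n : nat) (f : R3 R -> R) : Prop :=
  continuous f /\
  if n is m.+1 then
    forall k : 'I_3, (forall x, derivable f x (axis R k)) /\
                     Ck m (fun x => 'D_(axis R k) f x)
  else True.

Definition test_function (R : realType) (U : set (R3 R)) (f : R3 R -> R) : Prop :=
  (forall n, Ck n f) /\
  exists K : set (R3 R),
    [/\ compact K, K `<=` U & forall x, ~ K x -> f x = 0].

(* The indices [k + 1] and [k + 2] are taken modulo 3. *)
Definition smooth_curl (R : realType) (phi : 'I_3 -> R3 R -> R) (k : 'I_3)
    (x : R3 R) : R :=
  'D_(axis R (k + 1)) (phi (k + 2)) x - 'D_(axis R (k + 2)) (phi (k + 1)) x.

Definition distr_curl_real (R : realType) (U : set (R3 R))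
    (v w : 'I_3 -> R3 R -> R) : Prop :=
  forall phi : 'I_3 -> R3 R -> R, (forall k, test_function U (phi k)) ->
    \sum_(k < 3) \int[mu3 R]_(x in U) (v k x * smooth_curl phi k x) =
    \sum_(k < 3) \int[mu3 R]_(x in U) (w k x * phi k x).

(* [c] represents the distributional curl of [u] on the open set [U] and lies
   in L^2_loc(U); such a [c] is unique up to null sets.  Testing the real and
   imaginary parts against real test fields amounts, by linearity, to testing
   against complex ones. *)
Definition has_curl (R : realType) (U : set (R3 R)) (u c : R3 R -> C3 R) : Prop :=
  [/\ L2loc U c,
      distr_curl_real U (fun k x => complex.Re (u x 0 k))
                        (fun k x => complex.Re (c x 0 k)) &
      distr_curl_real U (fun k x => complex.Im (u x 0 k))
                        (fun k x => complex.Im (c x 0 k))].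

Definition Hloc_curl (R : realType) (u : R3 R -> C3 R) : Prop :=
  L2loc setT u /\ exists c, has_curl setT u c.

Definition periodic12 (R : realType) (u : R3 R -> C3 R) : Prop :=
  {ae mu3 R, forall x : R3 R, u (x + (1, 0, 0)) = u x} /\
  {ae mu3 R, forall x : R3 R, u (x + (0, 1, 0)) = u x}.

Definition Z {R : realType} : set (R3 R) :=
  [set x | 0 < x.1.1 < 1 /\ 0 < x.1.2 < 1].

(* Functions on [Z] are represented by functions on R^3 whose values outside
   [Z] are irrelevant. *)
Definition Hper_curl (R : realType) (Phi : R3 R -> C3 R) : Prop :=
  exists u, [/\ Hloc_curl u, periodic12 u & forall x, Z x -> Phi x = u x].

Definition dot3 (R : realType) (x y : R3 R) : R :=
  x.1.1 * y.1.1 + x.1.2 * y.1.2 + x.2 * y.2.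

Definition orthonormal3 (R : realType) (a b c : R3 R) : Prop :=
  [/\ dot3 a a = 1, dot3 b b = 1 & dot3 c c = 1] /\
  [/\ dot3 a b = 0, dot3 a c = 0 & dot3 b c = 0].

(* Near each boundary point and in suitable orthonormal coordinates, the
   closed set [E] is the region below the graph of a Lipschitz function. *)
Definition lipschitz_boundary (R : realType) (E : set (R3 R)) : Prop :=
  forall p : R3 R, (closure E `\` interior E) p ->
    exists (a b c : R3 R) (g : R * R -> R),
      [/\ orthonormal3 a b c, lipschitz g &
          \forall x \near p, E x <-> dot3 c x <= g (dot3 a x, dot3 b x)].

Definition periodic_extension (R : realType) (A : set (R3 R)) : set (R3 R) :=
  \bigcup_(k : int * int) [set ((k.1%:~R, k.2%:~R, 0) : R3 R) + x | x in A].

Definition is_obstacle (R : realType) (A : set (R3 R)) : Prop :=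
  [/\ compact A,
      A `<=` [set x | [/\ 0 <= x.1.1 <= 1, 0 <= x.1.2 <= 1 & 0 < x.2 < 1]] &
      lipschitz_boundary (periodic_extension A)].

(* [S n] is the obstacle attached to the parameter [eta n]. *)
Definition obstacle_sequence (R : realType) (eta : nat -> R)
    (S : nat -> set (R3 R)) : Prop :=
  [/\ forall n, 0 < eta n, eta @ \oo --> 0 & forall n, is_obstacle (S n)].

Definition asymptotically_disconnected (R : realType) (eta : nat -> R)
    (S : nat -> set (R3 R)) (j : nat) : Prop :=
  exists Phi curlPhi : nat -> R3 R -> C3 R,
  [/\ forall n, Hper_curl (Phi n) /\ has_curl Z (Phi n) (curlPhi n),
      ((eta n `^ 2^-1)%:E * L2norm Z (fun x => Phi n x - e j)%R)%E
        @[n --> \oo] --> 0%E,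
      forall n, {ae mu3 R, forall x : R3 R, Z x -> S n x -> Phi n x = 0} &
      ((eta n `^ (- 2^-1))%:E * L2norm Z (curlPhi n))%E @[n --> \oo] --> 0%E].

Definition asymptotically_connecting (R : realType) (eta : nat -> R)
    (S : nat -> set (R3 R)) (i : nat) : Prop :=
  let j := (3 - i)%N in
  exists Psi curlPsi : nat -> R3 R -> C3 R,
  [/\ forall n, Hper_curl (Psi n) /\ has_curl Z (Psi n) (curlPsi n),
      ((eta n `^ 2^-1)%:E *
         L2norm (Z `\` S n)
           (fun x => Psi n x - \1_[set y : R3 R | 0 < y.2] x *: e j)%R)%E
        @[n --> \oo] --> 0%E &
      ((eta n `^ (- 2^-1))%:E * L2norm (Z `\` S n) (curlPsi n))%E
        @[n --> \oo] --> 0%E].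

(* Main.v *)
Require Import Defs.
From mathcomp Require Import all_boot all_order all_algebra.
From mathcomp Require Import all_classical all_reals all_analysis.

(** Enlarging an obstacle relaxes what is asked of a connecting sequence and
    tightens what is asked of a disconnecting one, so the same fields and curls
    serve for both obstacles.  For (i), the norms over the smaller domain
    [Z `\` S n] are bounded by those over [Z `\` S' n] ([le_L2norm]), and
    multiplying by powers of [eta n], which are nonnegative, keeps the order; the
    limits then follow by squeezing against 0.  For (ii), the norms are taken
    over all of [Z], and a field that vanishes a.e. on [S n] vanishes a.e. on its
    subset [S' n]. *)

Import Order.TTheory GRing.Theory Num.Theory.

Local Open Scope classical_set_scope.
Local Open Scope ring_scope.

(** The integral of a nonnegative function is by definition the supremum of the
    integrals of the simple functions below it, and a larger function has more
    simple functions below it.  The integrands are arbitrary functions so that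
    [le_L2norm] can compare norms over arbitrary sets. *)
Lemma le_integralT_ge0 d (T : measurableType d) (R : realType)
    (mu : {measure set T -> \bar R}) (f g : T -> \bar R) :
  (forall x, 0 <= f x)%E -> (forall x, f x <= g x)%E ->
  (\int[mu]_x f x <= \int[mu]_x g x)%E.
Proof.
move=> f0 fg; rewrite !ge0_integralTE// => [|x]; last exact: le_trans (fg x).
apply: ereal_sup_le => _ [h /= hf <-].
by exists h => // x; exact: le_trans (fg x).
Qed.

Lemma le_L2norm (R : realType) (A B : set (R3 R)) (u : R3 R -> C3 R) :
  A `<=` B -> (L2norm A u <= L2norm B u)%E.
Proof.
move=> AB; rewrite /L2norm unlock/=.
have ge0 (D : set (R3 R)) x :
    (0 <= (`|\1_D x * C3norm (u x)| `^ 2)%:E :> \bar R)%E.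
  by rewrite lee_fin powR_ge0.
apply: gt0_ler_poweR; rewrite ?invr_ge0 ?ler0n//.
- by rewrite in_itv/= leey andbT; apply: integral_ge0 => x _; exact: ge0.
- by rewrite in_itv/= leey andbT; apply: integral_ge0 => x _; exact: ge0.
apply: le_integralT_ge0 => x; first exact: ge0.
rewrite lee_fin ge0_ler_powR ?nnegrE ?ler0n ?normr_ge0//.
rewrite !normrM ler_wpM2r ?normr_ge0// !ger0_norm// !indicE ler_nat.
by case: (boolP (x \in A)) => // /set_mem /AB /mem_set ->.
Qed.

Lemma cvg_scaled_L2norm_subset (R : realType) (r : nat -> R)
    (A B : nat -> set (R3 R)) (u : nat -> R3 R -> C3 R) :
  (forall n, 0 <= r n) -> (forall n, A n `<=` B n) ->
  ((r n)%:E * L2norm (B n) (u n))%E @[n --> \oo] --> 0%E ->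
  ((r n)%:E * L2norm (A n) (u n))%E @[n --> \oo] --> 0%E.
Proof.
move=> r0 AB cvgB; apply: squeeze_cvge (cvg_cst _) cvgB.
apply: nearW => n; apply/andP; split.
- by rewrite mule_ge0 ?lee_fin// Lnorm_ge0.
- by rewrite lee_wpmul2l ?lee_fin//; exact: le_L2norm.
Qed.

Theorem proposition5p1 (R : realType) (i : nat) (hi : i = 1%N \/ i = 2%N)
    (eta : nat -> R) (S S' : nat -> set (R3 R))
    (hS : obstacle_sequence eta S) (hS' : obstacle_sequence eta S')
    (hsub : forall n, S' n `<=` S n) :
  (asymptotically_connecting eta S' i -> asymptotically_connecting eta S i) /\
  (asymptotically_disconnected eta S i -> asymptotically_disconnected eta S' i).
Proof.
have subD n : Z `\` S n `<=` Z `\` S' n by exact: setDS.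
split=> [[Psi [c [HPsi cvgPsi cvgc]]]|[Phi [c [HPhi cvgPhi Phi0 cvgc]]]].
- exists Psi, c; split=> //.
  + by apply: (cvg_scaled_L2norm_subset _ _ _ _ _ _ subD cvgPsi) => n; exact: powR_ge0.
  + by apply: (cvg_scaled_L2norm_subset _ _ _ _ _ _ subD cvgc) => n; exact: powR_ge0.
- exists Phi, c; split=> // n.
  apply: negligibleS (Phi0 n) => x /=; apply: contra_not => Phix0 Zx S'x.
  by apply: Phix0 => //; exact: hsub.
Qed.
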